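(* Let $\mathbb{K}$ be a field and let $\mathcal{F}=\{f_1,\dots,f_s\}\subset \mathbb{K}[x_1,\dots,x_n]$ be a finite set of nonzero polynomials. The SAGBI Basis Detection algorithm (described in the context) applied to $\mathcal{F}$ is correct: it outputs the term orders, represented by weight vectors $\omega\in\mathbb{R}^n$ and up to equivalence with respect to $\mathcal{F}$, for which $\mathcal{F}$ forms a SAGBI basis of $S=\mathbb{K}[\mathcal{F}]$. That is, it returns a finite list of weight vectors such that: (i) for every $\omega$ in the list, $\mathcal{F}$ is a SAGBI basis of $\mathbb{K}[\mathcal{F}]$ with respect to $\omega$; and (ii) for every term order $\succ$ with respect to which $\mathcal{F}$ is a SAGBI basis of $\mathbb{K}[\mathcal{F}]$, the list contains a weight vector $\omega$ that agrees with $\succ$ on $\mathcal{F}$.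
   Context: $\mathbb{K}[\mathcal{F}]$ is the $\mathbb{K}$-subalgebra of $\mathbb{K}[x_1,\dots,x_n]$ generated by $\mathcal{F}$. For a term order $\succ$, $\mathrm{in}_\succ(f)$ is the leading monomial of $f\ne 0$. For a subalgebra $S$, the initial algebra is $\mathrm{in}_\succ(S)=\mathbb{K}[\mathrm{in}_\succ(f)\mid 0\neq f\in S]$. A subset $\mathcal{F}\subset S$ is a SAGBI basis of $S$ with respect to $\succ$ if the leading monomials $\mathrm{in}_\succ(f)$, $f\in\mathcal{F}$, generate $\mathrm{in}_\succ(S)$ as a $\mathbb{K}$-algebra. For $\omega\in\mathbb{R}^n$ and a polynomial $f$, $\mathrm{in}_\omega(f)$ is the sum of all terms $c_\alpha x^\alpha$ of $f$ with $\langle\alpha,\omega\rangle$ maximal. The weight $\omega$ agrees with a term order $\succ$ on $\mathcal{F}$ if for every $f\in\mathcal{F}$, $\mathrm{in}_\omega(f)$ is a single term whose monomial is $\mathrm{in}_\succ(f)$. ''$\mathcal{F}$ is a SAGBI basis with respect to $\omega$'' means that it is a SAGBI basis with respect to a term order agreeing with $\omega$ on $\mathcal{F}$. Two term orders are equivalent with respect to $\mathcal{F}$ if they have the same leading monomial on each $f\in\mathcal{F}$. The Newton polytope $\mathrm{New}(f)$ is the convex hull of the exponent vectors of the monomials of $f$, and $\mathrm{New}(\mathcal{F})=\mathrm{New}(f_1)+\dots+\mathrm{New}(f_s)$ (Minkowski sum). The (open) normal cone of a vertex $v$ of $\mathrm{New}(\mathcal{F})$ is $\{\omega\in\mathbb{R}^n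 : \langle\omega,v\rangle>\langle\omega,u\rangle \text{ for all } u\in \mathrm{New}(\mathcal{F}),\ u\neq v\}$. SAGBI Basis Detection algorithm. Input: $\mathcal{F}$. Compute $\mathrm{New}(\mathcal{F})$ and initialize an empty list. For each vertex $v$ of $\mathrm{New}(\mathcal{F})$: if the normal cone of $v$ intersects the orthant $\mathbb{R}^n_{\ge 0}$, pick any one $\omega$ in this intersection, check whether $\mathcal{F}$ is a SAGBI basis with respect to $\omega$ (by a known finite criterion for a fixed term order, e.g. checking that, for each binomial $P$ in a finite generating set of the toric ideal of algebraic relations among the leading monomials $\mathrm{in}(f_1),\dots,\mathrm{in}(f_s)$, the polynomial $P(f_1,\dots,f_s)$ subduces to $0$ by $\mathcal{F}$; this criterion correctly decides the SAGBI property for the given $\omega$), and if so add $\omega$ to the list. Return the list. *)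

(* Defs.v *)
From HB Require Import structures.
From mathcomp Require Import all_boot all_order all_algebra.
From mathcomp Require Import reals.
From mathcomp Require Export mpoly.

Set Implicit Arguments.
Unset Strict Implicit.
Unset Printing Implicit Defensive.

Import Order.TTheory GRing.Theory Num.Theory.
Local Open Scope ring_scope.

(** Subsets of an infinite type (subalgebras, polytopes, cones) are predicates
    [_ -> Prop]. *)

Section Sagbi.

Variables (K : fieldType) (n : nat).

Implicit Types (f p : {mpoly K[n]}) (m : 'X_{1..n}).
Implicit Types (G S : {mpoly K[n]} -> Prop).

Inductive subalg G : {mpoly K[n]} -> Prop :=
  | subalg_gen p : G p -> subalg G p
  | subalg_const c : subalg G c%:MP
  | subalg_add p q : subalg G p -> subalg G q -> subalg G (p + q)
  | subalg_mul p q : subalg G p -> subalg G q -> subalg G (p * q).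

(** [le m1 m2] reads "x^m1 is smaller than or equal to x^m2"; monomials are
    written additively, so [0%MM] is the monomial 1. *)
Record term_order (le : rel 'X_{1..n}) : Prop := TermOrder {
  term_order_refl : reflexive le;
  term_order_anti : antisymmetric le;
  term_order_trans : transitive le;
  term_order_total : total le;
  term_order_ge1 : forall m, le 0%MM m;
  term_order_mul : forall m1 m2 m, le m1 m2 -> le (m1 + m)%MM (m2 + m)%MM
}.

(** The [le]-largest exponent in the support; the neutral element [0%MM] is
    harmless for [f != 0], being minimal for a term order. *)
Definition lead_exp (le : rel 'X_{1..n}) f : 'X_{1..n} :=
  \big[(fun m1 m2 => if le m1 m2 then m2 else m1)/0%MM]_(m <- msupp f) m.

Definition lead_mon (le : rel 'X_{1..n}) f : {mpoly K[n]} := 'X_[lead_exp le f].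

Definition initial_algebra (le : rel 'X_{1..n}) S : {mpoly K[n]} -> Prop :=
  subalg (fun p => exists f, [/\ S f, f != 0 & p = lead_mon le f]).

Variable s : nat.
Implicit Types (F : s.-tuple {mpoly K[n]}).

Definition gen_subalg F : {mpoly K[n]} -> Prop := subalg (fun f => f \in F).

Definition is_sagbi_basis (le : rel 'X_{1..n}) F S : Prop :=
  (forall f, f \in F -> S f) /\
  (forall p, initial_algebra le S p <->
     subalg (fun q => exists2 f, f \in F & q = lead_mon le f) p).

Variable R : realType.
Implicit Types (w u v : 'rV[R]_n).

Definition pairing u v : R := \sum_(i < n) u 0 i * v 0 i.

Definition exp_vec m : 'rV[R]_n := \row_i (m i)%:R.

Definition init_form w f : {mpoly K[n]} :=
  \sum_(m <- msupp f | all (fun m' => pairing (exp_vec m') w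
                                       <= pairing (exp_vec m) w) (msupp f))
     f@_m *: 'X_[m].

Definition agrees w (le : rel 'X_{1..n}) F : Prop :=
  forall f, f \in F ->
    exists2 c : K, c != 0 & init_form w f = c *: lead_mon le f.

Definition is_sagbi_basis_weight w F S : Prop :=
  exists le : rel 'X_{1..n},
    [/\ term_order le, agrees w le F & is_sagbi_basis le F S].

Definition newton f : 'rV[R]_n -> Prop := fun x =>
  exists c : 'X_{1..n} -> R,
    [/\ forall m, 0 <= c m,
        \sum_(m <- msupp f) c m = 1
      & x = \sum_(m <- msupp f) c m *: exp_vec m].

Definition newton_sum F : 'rV[R]_n -> Prop := fun x =>
  exists2 y : 'I_s -> 'rV[R]_n,
    forall i, newton (tnth F i) (y i) & x = \sum_(i < s) y i.

(** Vertices of a polytope are its extreme points. *)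
Definition is_vertex (P : 'rV[R]_n -> Prop) v : Prop :=
  P v /\ forall x y (t : R), P x -> P y -> 0 < t < 1 ->
    v = t *: x + (1 - t) *: y -> x = v /\ y = v.

Definition normal_cone (P : 'rV[R]_n -> Prop) v : 'rV[R]_n -> Prop := fun w =>
  forall u, P u -> u <> v -> pairing w u < pairing w v.

Definition in_orthant w : Prop := forall i, 0 <= w 0 i.

(** [test] is the procedure used for the SAGBI check; only its answers on the
    weights that the algorithm may submit to it matter. *)
Definition decides_sagbi F (test : 'rV[R]_n -> bool) : Prop :=
  forall v w, is_vertex (newton_sum F) v -> normal_cone (newton_sum F) v w ->
    in_orthant w -> (test w <-> is_sagbi_basis_weight w F (gen_subalg F)).

(** [detection_loop F test vs L]: processing the vertices [vs] may produce the
    list [L].  The relation is nondeterministic because the weight picked in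
    each cone is arbitrary. *)
Inductive detection_loop F (test : 'rV[R]_n -> bool) :
    seq 'rV[R]_n -> seq 'rV[R]_n -> Prop :=
  | detection_nil : detection_loop F test [::] [::]
  | detection_skip v vs L :
      ~ (exists w, normal_cone (newton_sum F) v w /\ in_orthant w) ->
      detection_loop F test vs L -> detection_loop F test (v :: vs) L
  | detection_pick v vs L w :
      normal_cone (newton_sum F) v w -> in_orthant w ->
      detection_loop F test vs L ->
      detection_loop F test (v :: vs) (if test w then w :: L else L).

(** The vertices may be enumerated in any order. *)
Definition sagbi_detection F (test : 'rV[R]_n -> bool) (L : seq 'rV[R]_n) :
    Prop :=
  exists vs : seq 'rV[R]_n,
    [/\ uniq vs, forall v, v \in vs <-> is_vertex (newton_sum F) v
      & detection_loop F test vs L].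

End Sagbi.

(* Main.v *)
Require Import Defs.
From HB Require Import structures.
From mathcomp Require Import all_boot all_order all_algebra.
From mathcomp Require Import boolp reals.
From mathcomp Require Import mpoly.
From mathcomp Require Import ring lra.

Set Implicit Arguments.
Unset Strict Implicit.
Unset Printing Implicit Defensive.

Import Order.TTheory GRing.Theory Num.Theory.
Local Open Scope ring_scope.

(** Soundness of the returned list is immediate, since a weight enters it only
    after passing the test.  The content is that no term order is missed.

    Fix a term order [le].  Adding up the leading exponents of the [f] in [F]
    gives a point [lead_vertex] of the Newton polytope of [F], and a weight [w]
    lies in its open normal cone exactly when, on each [f], the leading
    exponent is the unique maximizer of [w] ([normal_cone_lead_vertex]); such a
    [w] agrees with [le] ([agrees_normal_cone]).  So it suffices that this cone
    meets the nonnegative orthant: then the point is a vertex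
    ([normal_cone_vertex]), the loop cannot skip it, and whichever weight it
    picks there agrees with [le], hence passes the test as soon as [F] is a
    SAGBI basis for [le].

    A nonnegative weight in the cone exists because the differences
    [a - b] of exponents with [b] strictly below [a] are closed under addition
    and never zero.  Any finite set of vectors taken from such a set of integer
    vectors lies in an open half-space ([separation], by Fourier-Motzkin
    elimination).  This is applied to the differences between the leading and
    the other exponents of each [f], together with the unit vectors, which
    force the weight to be nonnegative ([exists_weight]).

    That a run of the algorithm exists at all needs the Newton polytope to have
    finitely many vertices; each of them is a sum of exponents taken from the
    supports ([vertex_newton_sum]). *)

(** * The pairing *)

Section Pairing.

Variables (n : nat) (R : realType).
Implicit Types (u v w : 'rV[R]_n) (a : R).

Lemma pairingC u v : pairing u v = pairing v u.
Proof. by apply: eq_bigr => i _; rewrite mulrC. Qed.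

Lemma pairingDr w u v : pairing w (u + v) = pairing w u + pairing w v.
Proof. by rewrite -big_split; apply: eq_bigr => i _; rewrite mxE mulrDr. Qed.

Lemma pairingZr w a v : pairing w (a *: v) = a * pairing w v.
Proof. by rewrite mulr_sumr; apply: eq_bigr => i _; rewrite mxE mulrCA. Qed.

Lemma pairing_sumr (I : Type) (r : seq I) (Q : pred I) w (y : I -> 'rV[R]_n) :
  pairing w (\sum_(i <- r | Q i) y i) = \sum_(i <- r | Q i) pairing w (y i).
Proof.
apply: (big_morph (pairing w) (pairingDr w)).
by apply: big1 => i _; rewrite mxE mulr0.
Qed.

Lemma pairing_delta i v : pairing (delta_mx 0 i) v = v 0 i.
Proof.
rewrite /pairing (bigD1 i) //= big1 => [|j ne]; rewrite mxE eqxx.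
  by rewrite eqxx mul1r addr0.
by rewrite (negPf ne) mul0r.
Qed.

End Pairing.

(** * Separating finitely many integer vectors from the origin *)

Section Separation.

Variable R : realType.

Lemma exists_between_seq (A B : seq R) :
  (forall a b, a \in A -> b \in B -> a < b) ->
  exists t, (forall a, a \in A -> a < t) /\ (forall b, b \in B -> t < b).
Proof.
elim: A => [|a A IH] AB.
  elim: B {AB} => [|b B [t [_ tB]]]; first by exists 0.
  exists (Num.min t (b - 1)); split=> // c.
  rewrite inE gt_min => /predU1P [->|/tB ->] //.
  by apply/orP; right; lra.
have [|t [At tB]] := IH; first by move=> x y xA; apply: AB; rewrite inE xA orbT.
have {}AB b : b \in B -> a < b by apply: AB; rewrite inE eqxx.
have [t' [at' t'B]] : exists t', a < t' /\ (forall b, b \in B -> t' < b).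
  elim: B AB {IH At tB} => [|b B IH] AB; first by exists (a + 1); split=> //; lra.
  have [|t' [at' t'B]] := IH; first by move=> c cB; apply: AB; rewrite inE cB orbT.
  have ab : a < b by apply: AB; rewrite inE eqxx.
  exists (Num.min t' ((a + b) / 2)); split=> [|c].
    by rewrite lt_min at' /=; lra.
  by rewrite inE gt_min => /predU1P [->|/t'B ->] //; apply/orP; right; lra.
exists (Num.max t t'); split=> [c|b bB]; last by rewrite gt_max tB ?t'B.
by rewrite inE lt_max => /predU1P [->|/At ->] //; rewrite at' orbT.
Qed.

Variable n : nat.
Implicit Types (x y d : 'rV[int]_n) (D : seq 'rV[int]_n) (w : 'rV[R]_n).

(** A form of Gordan's theorem that avoids certificates: since [P] is closed
    under addition and misses [0], a vanishing positive integer combination of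
    vectors of [D] is impossible, so a separating [w] must exist.  The induction
    is on the number of coordinates that may be nonzero on [D], and [w] is
    adjusted one coordinate at a time. *)
Lemma separation (P : 'rV[int]_n -> Prop) D :
  (forall x y, P x -> P y -> P (x + y)) -> ~ P 0 -> (forall d, d \in D -> P d) ->
  exists w, forall d, d \in D -> 0 < pairing w (map_mx intr d).
Proof.
move=> PD P0.
have PZ (a : int) x : 0 < a -> P x -> P (a *: x).
  case: a => // -[//|k] _ Px; elim: k => [|k IH]; first by rewrite scale1r.
  by rewrite intS scalerDl scale1r; apply: PD.
suff elimination k D' : (k <= n)%N -> (forall d, d \in D' -> P d) ->
    (forall d (i : 'I_n), d \in D' -> (k <= i)%N -> d 0 i = 0) ->
    exists w, forall d, d \in D' -> 0 < pairing w (map_mx intr d).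
  move=> DP; apply: (elimination n) => // d i _.
  by rewrite leqNgt ltn_ord.
elim: k D' => [|k IH] D' kn DP Dk.
  exists 0 => d dD; case: P0; suff <- : d = 0 by apply: DP.
  by apply/rowP => i; rewrite mxE; apply: Dk.
(* [comb x y] cancels the coordinate [i0] with positive coefficients, so it
   stays in [P]; together with the vectors already zero there, these
   combinations form a system with one coordinate fewer. *)
pose i0 := Ordinal kn.
pose Dpos := [seq d : 'rV[int]_n <- D' | 0 < d 0 i0].
pose Dneg := [seq d : 'rV[int]_n <- D' | d 0 i0 < 0].
pose comb (x y : 'rV[int]_n) := (- y 0 i0) *: x + (x 0 i0) *: y.
have [|||w wP] := IH ([seq d : 'rV[int]_n <- D' | d 0 i0 == 0] ++
                   [seq comb x y | x <- Dpos, y <- Dneg]); first exact: ltnW.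
- move=> d; rewrite mem_cat mem_filter => /orP [/andP [_ /DP //]|].
  move=> /allpairsP [[x y] /= []]; rewrite !mem_filter.
  move=> /andP [x0 /DP Px] /andP [y0 /DP Py] ->.
  by apply: PD; apply: PZ; rewrite ?oppr_gt0.
- move=> d i; rewrite mem_cat mem_filter leq_eqVlt => dD /orP [/eqP ki|ki].
    have -> : i = i0 by apply/val_inj.
    case/orP: dD => [/andP [/eqP //]|/allpairsP [[x y] /= [_ _ ->]]].
    by rewrite !mxE; ring.
  case/orP: dD => [/andP [_ dD]|]; first exact: Dk.
  move=> /allpairsP [[x y] /= []]; rewrite !mem_filter.
  by move=> /andP [_ xD] /andP [_ yD] ->; rewrite !mxE !(Dk _ i) // !mulr0 addr0.
pose p (d : 'rV[int]_n) := pairing w (map_mx intr d).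
pose q (d : 'rV[int]_n) : R := (d 0 i0)%:~R.
(* Moving [w] by [t] in direction [i0] does not change the pairing with the
   eliminated system.  On [d] the new pairing is [p d + t * q d], which bounds
   [t] below when [q d > 0] and above when [q d < 0]; positivity of [w] on
   [comb x y] says exactly that the bounds are compatible. *)
have [|t [tpos tneg]] := @exists_between_seq [seq - p x / q x | x <- Dpos]
                           [seq p y / - q y | y <- Dneg].
  move=> _ _ /mapP [x xD ->] /mapP [y yD ->].
  have : 0 < p (comb x y).
    apply: wP; rewrite mem_cat; apply/orP; right.
    by apply/allpairsP; exists (x, y).
  move: xD yD; rewrite !mem_filter => /andP [x0 _] /andP [y0 _].
  have qx : 0 < q x by rewrite ltr0z.
  have qy : 0 < - q y by rewrite oppr_gt0 ltrz0.
  rewrite /p /comb map_mxD !map_mxZ pairingDr !pairingZr rmorphN /= -/(q _) -/(q _).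
  rewrite -/(p x) -/(p y) => pos.
  by rewrite ltr_pdivrMr // mulrAC ltr_pdivlMr //; lra.
exists (w + t *: delta_mx 0 i0) => d dD.
rewrite pairingC pairingDr pairingZr pairingC -/(p d) [X in t * X]pairingC.
rewrite pairing_delta mxE -/(q d).
have [d0|d0|d0] := ltgtP (d 0 i0) 0.
- have qd : 0 < - q d by rewrite oppr_gt0 ltrz0.
  have : t < p d / - q d.
    by apply: tneg; apply/mapP; exists d => //; rewrite mem_filter d0.
  by rewrite ltr_pdivlMr //; lra.
- have qd : 0 < q d by rewrite ltr0z.
  have : - p d / q d < t.
    by apply: tpos; apply/mapP; exists d => //; rewrite mem_filter d0.
  by rewrite ltr_pdivrMr //; lra.
- rewrite /q d0 mulr0 addr0; apply: wP.
  by rewrite mem_cat mem_filter d0 eqxx dD.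
Qed.

End Separation.

(** * Term orders *)

Section TermOrder.

Variables (n : nat) (le : rel 'X_{1..n}).
Hypothesis le_to : term_order le.
Implicit Types (a b m : 'X_{1..n}).

Let exp_diff a b : 'rV[int]_n := \row_i ((a i)%:Z - (b i)%:Z).

Let positive (d : 'rV[int]_n) := exists a b, [/\ le b a, a != b & d = exp_diff a b].

Lemma positiveD x y : positive x -> positive y -> positive (x + y).
Proof.
move=> [a [b [ba ab ->]]] [a' [b' [ba' ab' ->]]].
have [lexx lea letr _ _ leD] := le_to.
have le1 : le (b + b')%MM (b + a')%MM by rewrite ![(b + _)%MM]addmC; apply: leD.
have le2 : le (b + a')%MM (a + a')%MM by apply: leD.
exists (a + a')%MM, (b + b')%MM; split.
- exact: letr le1 le2.
- apply: contra_neq ab => E; rewrite -E in le1.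
  by apply: (@addIm _ a'); apply: lea; rewrite le1 le2.
- by apply/rowP => i; rewrite !mxE !mnmDE !PoszD; ring.
Qed.

Lemma positive0 : ~ positive 0.
Proof.
move=> [a [b [_ /eqP ab /rowP E]]]; apply: ab; apply/mnmP => i.
by have := E i; rewrite !mxE => /esym/subr0_eq [].
Qed.

(** The finite form of the representability of term orders by weights.
    Nonnegativity comes from the pairs [(U_(i), 0)], comparable because [1] is
    the least monomial. *)
Lemma exists_weight (R : realType) (s : seq ('X_{1..n} * 'X_{1..n})) :
  (forall a b, (a, b) \in s -> le b a /\ a != b) ->
  exists w : 'rV[R]_n, in_orthant w /\
    forall a b, (a, b) \in s -> pairing w (exp_vec R b) < pairing w (exp_vec R a).
Proof.
move=> sP; pose s' := [seq (U_(i)%MM, 0%MM) | i <- enum 'I_n] ++ s.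
pose D := [seq exp_diff ab.1 ab.2 | ab <- s'].
have [d|w wP] := @separation R n positive D positiveD positive0.
  move=> /mapP [[a b] abs ->]; exists a, b.
  suff [ba ab] : le b a /\ a != b by split.
  move: abs; rewrite mem_cat => /orP [/mapP [i _ [-> ->]]|]; last exact: sP.
  split; first exact: term_order_ge1.
  by apply/eqP => /mnmP /(_ i); rewrite mnmE mnm0E eqxx.
have {}wP a b : (a, b) \in s' -> pairing w (exp_vec R b) < pairing w (exp_vec R a).
  move=> /(map_f (fun ab => exp_diff ab.1 ab.2)) /wP /=.
  have -> : map_mx intr (exp_diff a b) = exp_vec R a + (-1) *: exp_vec R b.
    by apply/rowP => i; rewrite !mxE rmorphB mulN1r.
  by rewrite pairingDr pairingZr; lra.
exists w; split=> [i|a b abs]; last by apply: wP; rewrite mem_cat abs orbT.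
have : pairing w (exp_vec R 0%MM) < pairing w (exp_vec R U_(i)%MM).
  by apply: wP; rewrite mem_cat map_f ?mem_enum.
have -> : exp_vec R (0%MM : 'X_{1..n}) = 0 *: 0.
  by apply/rowP => j; rewrite !mxE mnm0E mul0r.
have -> : exp_vec R U_(i)%MM = delta_mx 0 i.
  by apply/rowP => j; rewrite !mxE mnmE eq_sym.
by rewrite pairingZr mul0r pairingC pairing_delta => /ltW.
Qed.

Variable K : fieldType.
Implicit Types f : {mpoly K[n]}.

(** The fold defining the leading exponent starts at [0], which could a priori
    be returned without lying in the support; minimality of [0] and
    antisymmetry rule this out for a nonempty support. *)
Lemma lead_expP f : f != 0 ->
  lead_exp le f \in msupp f /\ forall m, m \in msupp f -> le m (lead_exp le f).
Proof.
have [lexx lea letr tot ge1 _] := le_to.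
rewrite -msupp_eq0 /lead_exp; pose op m1 m2 := if le m1 m2 then m2 else m1.
rewrite -/op.
have max (r : seq 'X_{1..n}) :
    (\big[op/0%MM]_(m <- r) m \in 0%MM :: r) /\
    forall m, m \in r -> le m (\big[op/0%MM]_(m <- r) m).
  elim: r => [|a r [IH1 IH2]]; first by rewrite big_nil inE eqxx.
  rewrite big_cons; set M := \big[_/_]_(_ <- _) _ in IH1 IH2 *.
  rewrite /op; have [aM|Ma] := boolP (le a M); split.
  - by move: IH1; rewrite !inE => /orP [->|->]; rewrite ?orbT.
  - by move=> m; rewrite inE => /predU1P [->|/IH2].
  - by rewrite !inE eqxx orbT.
  - move=> m; rewrite inE => /predU1P [->|/IH2 mM]; first exact: lexx.
    by apply: letr mM _; have := tot a M; rewrite (negPf Ma).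
case: (msupp f) (max (msupp f)) => // a r [big_in big_max] _; split=> //.
move: big_in; rewrite inE => /predU1P [E|//].
have /big_max := mem_head a r; rewrite E => a0.
suff -> : 0%MM = a by rewrite mem_head.
by apply: lea; rewrite a0 ge1.
Qed.

End TermOrder.

(** * Newton polytopes and their vertices *)

Section Newton.

Variables (K : fieldType) (n s : nat) (R : realType).
Implicit Types (f : {mpoly K[n]}) (w v : 'rV[R]_n) (F : s.-tuple {mpoly K[n]}).

Lemma newton_exp_vec f m : m \in msupp f -> newton f (exp_vec R m).
Proof.
move=> mf; exists (fun m' => (m' == m)%:R); split=> [m'||].
- exact: ler0n.
- rewrite (bigD1_seq m) //= eqxx big1 ?addr0 // => m' /negPf -> /=.
  by [].
- rewrite (bigD1_seq m) //= eqxx big1 ?addr0 ?scale1r // => m' /negPf ->.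
  by rewrite scale0r.
Qed.

(** A convex combination of numbers reaches the largest of them only if all the
    mass sits on it. *)
Lemma newton_max f w m0 x : m0 \in msupp f ->
  (forall m, m \in msupp f -> m != m0 ->
     pairing w (exp_vec R m) < pairing w (exp_vec R m0)) ->
  newton f x ->
  pairing w x <= pairing w (exp_vec R m0) ?= iff (x == exp_vec R m0).
Proof.
move=> m0f wmax [c [c0 c1 ->]].
have max m : m \in msupp f ->
    c m * pairing w (exp_vec R m) <= c m * pairing w (exp_vec R m0).
  move=> mf; apply: ler_wpM2l => //.
  by have [->|/(wmax m mf)/ltW] := eqVneq m m0.
have sumE : pairing w (\sum_(m <- msupp f) c m *: exp_vec R m) =
            \sum_(m <- msupp f) c m * pairing w (exp_vec R m).
  by rewrite pairing_sumr; apply: eq_bigr => m _; rewrite pairingZr.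
have m0E : pairing w (exp_vec R m0) =
           \sum_(m <- msupp f) c m * pairing w (exp_vec R m0).
  by rewrite -mulr_suml c1 mul1r.
split; first by rewrite sumE m0E big_seq [leRHS]big_seq ler_sum.
apply/eqP/eqP => [|->] //; rewrite sumE m0E => E.
have cz m : m \in msupp f -> m != m0 -> c m = 0.
  move=> mf mm0.
  have : \sum_(m <- msupp f)
      (c m * pairing w (exp_vec R m0) - c m * pairing w (exp_vec R m)) = 0.
    by rewrite sumrB E subrr.
  rewrite big_seq => /eqP; rewrite psumr_eq0 => [|i /max]; last by rewrite subr_ge0.
  move=> /allP /(_ m mf); rewrite mf -mulrBr mulf_eq0 => /orP [/eqP //|].
  by rewrite subr_eq0 => /eqP E'; have := wmax m mf mm0; rewrite E' ltxx.
have c1' : c m0 = 1.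
  rewrite -c1 (bigD1_seq m0) //= big_seq_cond big1 ?addr0 // => m /andP [mf mm0].
  exact: cz.
rewrite (bigD1_seq m0) //= c1' scale1r big_seq_cond big1 ?addr0 // => m /andP [mf mm0].
by rewrite cz // scale0r.
Qed.

(** The unique maximizer of a linear form is extreme: were an endpoint of a
    segment through [v] different from [v], the form would be strictly smaller
    there and hence at [v]. *)
Lemma normal_cone_vertex (P : 'rV[R]_n -> Prop) v w :
  P v -> normal_cone P v w -> is_vertex P v.
Proof.
move=> Pv cone; split=> // x y t Px Py /andP [t0 t1] vE.
have le u : P u -> pairing w u <= pairing w v.
  by move=> Pu; have [->|/eqP/(cone _ Pu)/ltW] := eqVneq u v.
have E : pairing w v = t * pairing w x + (1 - t) * pairing w y.
  by rewrite {1}vE pairingDr !pairingZr.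
have [lx ly] := (le x Px, le y Py).
split; apply: contrapT => ne.
- by have := cone x Px ne; nra.
- by have := cone y Py ne; nra.
Qed.

(** If some summand [y i] puts a weight strictly between [0] and [1] on an
    exponent [m], then [v] is a proper convex combination of the two points
    obtained by replacing [y i] with [exp_vec m] and with the renormalized rest
    [z] of its combination; extremality then forces [y i = exp_vec m]. *)
Lemma vertex_newton_sum F v : is_vertex (newton_sum F) v ->
  exists2 m : 'I_s -> 'X_{1..n},
    forall i, m i \in msupp (tnth F i) & v = \sum_i exp_vec R (m i).
Proof.
move=> [[y yF vE] ext].
suff /choice [m mP] : forall i, exists m,
    m \in msupp (tnth F i) /\ y i = exp_vec R m.
  exists m => [i|]; first by case: (mP i).
  by rewrite vE; apply: eq_bigr => i _; case: (mP i).
move=> i; have [c [c0 c1 yE]] := yF i; set f := tnth F i in c1 yE *.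
have [m mf cm] : exists2 m, m \in msupp f & 0 < c m.
  apply: contrapT => no; have := oner_neq0 R; rewrite -c1 big_seq big1 ?eqxx // => m mf.
  by apply/eqP; rewrite eq_le c0 andbT leNgt; apply/negP => cm; apply: no; exists m.
exists m; split=> //.
have restE : \sum_(m' <- msupp f | m' != m) c m' = 1 - c m.
  by rewrite -c1 (bigD1_seq m) //= addrAC subrr add0r.
have [cm1|cm1] := eqVneq (c m) 1.
  rewrite yE (bigD1_seq m) //= cm1 scale1r big_seq_cond big1 ?addr0 //.
  move=> m' /andP [m'f m'm].
  have /eqP := restE; rewrite cm1 subrr big_seq_cond psumr_eq0 //.
  move=> /allP /(_ m' m'f); rewrite m'f m'm /= => /eqP ->; exact: scale0r.
have cm1' : 0 < 1 - c m.
  have : 0 <= 1 - c m by rewrite -restE; apply: sumr_ge0.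
  by rewrite subr_ge0 subr_gt0 lt_neqAle cm1.
pose z := \sum_(m' <- msupp f | m' != m) (c m' / (1 - c m)) *: exp_vec R m'.
have zf : newton f z.
  exists (fun m' => if m' == m then 0 else c m' / (1 - c m)); split.
  - by move=> m'; case: eqP => // _; rewrite divr_ge0 // ltW.
  - rewrite (bigD1_seq m) //= eqxx add0r.
    rewrite (eq_bigr (fun m' => c m' / (1 - c m))); last by move=> m' /negPf ->.
    by rewrite -mulr_suml restE divff // gt_eqF.
  - rewrite [RHS](bigD1_seq m) //= eqxx scale0r add0r.
    by apply: eq_bigr => m' /negPf ->.
have yzE : y i = c m *: exp_vec R m + (1 - c m) *: z.
  rewrite yE (bigD1_seq m) //= scaler_sumr; congr (_ + _); apply: eq_bigr => m' _.
  by rewrite scalerA mulrC divfK // gt_eqF.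
pose rest := \sum_(j | j != i) y j.
have restP x : newton f x -> newton_sum F (x + rest).
  move=> fx; exists (fun j => if j == i then x else y j) => [j|].
    by case: eqP => [->|].
  rewrite (bigD1 i) //= eqxx; congr (_ + _).
  by apply: eq_bigr => j /negPf ->.
have vE' : v = y i + rest by rewrite vE (bigD1 i).
have [] := ext _ _ (c m) (restP _ (newton_exp_vec mf)) (restP _ zf).
- by rewrite cm /=; lra.
- rewrite vE' yzE; apply/rowP => j; rewrite !mxE; ring.
- by rewrite vE' => /addIr ->.
Qed.

Lemma vertices_enum F :
  exists2 vs, uniq vs & forall v : 'rV[R]_n, v \in vs <-> is_vertex (newton_sum F) v.
Proof.
pose S := flatten [seq msupp f | f : {mpoly K[n]} <- F].
pose sums := [seq \sum_i exp_vec R (ssval (phi i)) | phi : {ffun 'I_s -> seq_sub S}].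
exists [seq v <- undup sums | `[< is_vertex (newton_sum F) v >]].
  exact: filter_uniq (undup_uniq _).
move=> v; rewrite mem_filter mem_undup; split=> [/andP [/asboolP //]|vV].
apply/andP; split; first exact/asboolP.
have [m mF ->] := vertex_newton_sum vV.
have mS i : m i \in S by apply/flatten_mapP; exists (tnth F i); rewrite ?mem_tnth.
apply/mapP; exists [ffun i => SeqSub (mS i)]; first by rewrite mem_enum.
by apply: eq_bigr => i _; rewrite ffunE.
Qed.

End Newton.

(** * The vertex selected by a term order *)

Section Agreement.

Variables (K : fieldType) (n s : nat) (R : realType).
Variables (le : rel 'X_{1..n}) (F : s.-tuple {mpoly K[n]}).
Hypotheses (le_to : term_order le) (F0 : forall f, f \in F -> f != 0).
Implicit Types (w : 'rV[R]_n) (f : {mpoly K[n]}).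

Definition lead_vertex : 'rV[R]_n := \sum_i exp_vec R (lead_exp le (tnth F i)).

Let lead_supp i : lead_exp le (tnth F i) \in msupp (tnth F i).
Proof. by case: (lead_expP le_to (F0 (mem_tnth i F))). Qed.

Lemma lead_vertex_in : newton_sum F lead_vertex.
Proof.
exists (fun i => exp_vec R (lead_exp le (tnth F i))) => // i.
exact/newton_exp_vec/lead_supp.
Qed.

(** Linear maximization over a Minkowski sum splits over the summands.  For the
    direct implication the competitor of [lead_vertex] changes one summand
    only. *)
Lemma normal_cone_lead_vertex w :
  normal_cone (newton_sum F) lead_vertex w <->
  forall f m, f \in F -> m \in msupp f -> m != lead_exp le f ->
    pairing w (exp_vec R m) < pairing w (exp_vec R (lead_exp le f)).
Proof.
split=> [cone _ m /tnthP [i ->] mf ne|wmax u [y yF ->] ne].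
  pose rest := \sum_(j | j != i) exp_vec R (lead_exp le (tnth F j)).
  have vE : lead_vertex = exp_vec R (lead_exp le (tnth F i)) + rest.
    by rewrite /lead_vertex (bigD1 i).
  suff : pairing w (exp_vec R m + rest) < pairing w lead_vertex.
    by rewrite vE !pairingDr ltrD2r.
  apply: cone; last first.
    rewrite vE => /addIr /rowP E; case/eqP: ne; apply/mnmP => j.
    by have /eqP := E j; rewrite !mxE eqr_nat => /eqP.
  exists (fun j => exp_vec R (if j == i then m else lead_exp le (tnth F j))).
    by move=> j; apply: newton_exp_vec; case: eqP => [->|].
  rewrite (bigD1 i) //= eqxx; congr (_ + _).
  by apply: eq_bigr => j /negPf ->.
have max i : pairing w (y i) <= pairing w (exp_vec R (lead_exp le (tnth F i)))
               ?= iff (y i == exp_vec R (lead_exp le (tnth F i))).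
  apply: newton_max (yF i); first exact: lead_supp.
  by move=> m; apply: wmax; apply: mem_tnth.
have [sum_le sum_eq] := leif_sum (fun i (_ : xpredT i) => max i).
rewrite !pairing_sumr lt_neqAle sum_le andbT sum_eq.
apply/negP => /forallP all_eq; apply: ne; apply: eq_bigr => i _.
exact/eqP/all_eq.
Qed.

Lemma agrees_normal_cone w :
  normal_cone (newton_sum F) lead_vertex w -> agrees w le F.
Proof.
move=> /normal_cone_lead_vertex wmax f fF.
have [leadf _] := lead_expP le_to (F0 fF).
exists f@_(lead_exp le f); first by rewrite -mcoeff_msupp.
rewrite /init_form -big_filter.
suff -> : [seq m <- msupp f | all (fun m' => pairing (exp_vec R m') w <=
             pairing (exp_vec R m) w) (msupp f)] = [:: lead_exp le f].
  by rewrite big_seq1.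
rewrite -(filter_pred1_uniq (msupp_uniq f) leadf); apply: eq_in_filter => m mf.
apply/allP/eqP => [mmax|-> m' m'f].
  apply: contrapT => /eqP ne; have := mmax _ leadf.
  by rewrite ![pairing _ w]pairingC leNgt wmax.
rewrite ![pairing _ w]pairingC.
by have [->|/(wmax f m' fF m'f)/ltW] := eqVneq m' (lead_exp le f).
Qed.

Lemma lead_vertex_cone :
  exists w, normal_cone (newton_sum F) lead_vertex w /\ in_orthant w.
Proof.
have [|w [w0 wP]] := @exists_weight _ _ le_to R
  [seq (lead_exp le f, m) | f <- F, m <- [seq m <- msupp f | m != lead_exp le f]].
  move=> _ _ /allpairsPdep [f [m [fF + [-> ->]]]].
  rewrite mem_filter eq_sym => /andP [-> mf]; split=> //.
  by case: (lead_expP le_to (F0 fF)) => _; apply.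
exists w; split=> //; apply/normal_cone_lead_vertex => f m fF mf ne.
by apply: wP; apply/allpairsPdep; exists f, m; rewrite mem_filter ne.
Qed.

End Agreement.

(** * Runs of the detection loop *)

Section Loop.

Variables (K : fieldType) (n s : nat) (R : realType).
Variables (F : s.-tuple {mpoly K[n]}) (test : 'rV[R]_n -> bool).
Implicit Types (vs L : seq 'rV[R]_n) (v w : 'rV[R]_n).

Lemma detection_loop_total vs : exists L, detection_loop F test vs L.
Proof.
elim: vs => [|v vs [L loopL]]; first by exists [::]; constructor.
have [[w [wv w0]]|no] :=
  pselect (exists w, normal_cone (newton_sum F) v w /\ in_orthant w).
  by exists (if test w then w :: L else L); constructor.
by exists L; constructor.
Qed.

Lemma detection_loop_sound vs L w : detection_loop F test vs L -> w \in L ->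
  exists v, [/\ v \in vs, normal_cone (newton_sum F) v w, in_orthant w & test w].
Proof.
elim=> // [v {}vs {}L _ _ IH wL|v {}vs {}L w' w'v w'0 _ IH].
  by have [v' [v'vs *]] := IH wL; exists v'; rewrite inE v'vs orbT.
have old : w \in L -> exists v', [/\ v' \in v :: vs,
    normal_cone (newton_sum F) v' w, in_orthant w & test w].
  by move=> wL; have [v' [v'vs *]] := IH wL; exists v'; rewrite inE v'vs orbT.
case: ifP => [tw|_]; last exact: old.
by rewrite inE => /predU1P [->|//]; exists v; rewrite mem_head.
Qed.

Lemma detection_loop_complete vs L v : detection_loop F test vs L -> v \in vs ->
  (exists w, normal_cone (newton_sum F) v w /\ in_orthant w) ->
  exists w, [/\ normal_cone (newton_sum F) v w, in_orthant w & test w -> w \in L].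
Proof.
elim=> // [v' {}vs {}L no _ IH|v' {}vs {}L w wv' w0 _ IH].
  by rewrite inE => /predU1P [-> /no|/IH].
rewrite inE => /predU1P [-> _|/IH {}IH /IH [w' [w'v w'0 w'L]]].
  by exists w; split=> // ->; rewrite mem_head.
exists w'; split=> // /w'L w'inL; case: ifP => // _; by rewrite inE w'inL orbT.
Qed.

End Loop.

Theorem theorem3p3 (K : fieldType) (R : realType) (n s : nat)
    (F : s.-tuple {mpoly K[n]}) (hF : forall f, f \in F -> f != 0)
    (test : 'rV[R]_n -> bool) (htest : decides_sagbi F test) :
  (exists L : seq 'rV[R]_n, sagbi_detection F test L) /\
  (forall L : seq 'rV[R]_n, sagbi_detection F test L ->
     (forall w, w \in L -> is_sagbi_basis_weight w F (gen_subalg F)) /\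
     (forall le : rel 'X_{1..n}, term_order le ->
        is_sagbi_basis le F (gen_subalg F) ->
        exists2 w, w \in L & agrees w le F)).
Proof.
split.
  have [vs vs_uniq vsP] := vertices_enum R F.
  by have [L loopL] := detection_loop_total F test vs; exists L, vs.
move=> L [vs [_ vsP loopL]]; split=> [w wL|le le_to sagbi].
  have [v [/vsP vV wv w0 tw]] := detection_loop_sound loopL wL.
  exact/(htest _ _ vV wv w0).
have cone := lead_vertex_cone R le_to hF.
have vV : is_vertex (newton_sum F) (lead_vertex R le F).
  case: cone => w [wv _]; apply: normal_cone_vertex wv.
  exact: lead_vertex_in.
have [w [wv w0 wL]] := detection_loop_complete loopL (proj2 (vsP _) vV) cone.
have wle := agrees_normal_cone le_to hF wv.
by exists w => //; apply: wL; apply/(htest _ _ vV wv w0); exists le.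
Qed.
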